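(* There exist continuum many positive transcendental real numbers $\sigma$ with the following property: for every integer $m\ge2$ and every Liouville number $\xi$, the number $\sigma\xi^m$ is a Liouville number.
   Context: A real number $\xi$ is a Liouville number if for every integer $N\ge 1$ there exist infinitely many pairs $(p,q)\in\mathbb{Z}\times\mathbb{Z}_{>0}$ with $q\ge 2$ such that $0<|\xi-p/q|<q^{-N}$. ''Continuum many'' means that the set of such $\sigma$ has the cardinality of $\mathbb{R}$. *)

(* Defs.v *)
From mathcomp Require Import all_boot all_order all_algebra.
From mathcomp Require Import boolp classical_sets cardinality reals.

Set Implicit Arguments.
Unset Strict Implicit.
Unset Printing Implicit Defensive.

Import Order.TTheory GRing.Theory Num.Theory.

Local Open Scope classical_set_scope.
Local Open Scope ring_scope.

(* The pairs (p, q) are counted as pairs, not as fractions p / q, and are not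
   required to be coprime. *)
Definition Liouville (R : realType) (xi : R) : Prop :=
  forall N : nat, (1 <= N)%N ->
    infinite_set
      [set pq : int * int | 2 <= pq.2 /\
         (0 : R) < `|xi - pq.1%:~R / pq.2%:~R| < pq.2%:~R ^- N].

Definition transcendental (R : realType) (x : R) : Prop :=
  ~ algebraicOver (ratr : rat -> R) x.

(* Main.v *)
(**
  Let [sigma] be the sum of a series with terms [e_j / D_j], [e_j] in [{1, 2}],
  where [D_(j+1) = D_j l_j] and [l_j] is a prime exceeding [D_j ^ (j+2)].  The
  partial sum with denominator [D_i] is within [3 / D_(i+1)] of [sigma].  If [p/q]
  is a very good approximation of a Liouville number [xi], the sparsity of the
  [D_i] provides some [D_i] bounded by a fixed power of [q] with [D_(i+1)] above a
  much larger power of [q], so the [i]-th partial sum times [(p/q)^m] is a very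
  good approximation of [sigma xi^m].  The latter is therefore rational or
  Liouville.  If it were rational it would eventually be equal to its
  approximations, which is impossible for [m >= 2]: the prime [l_(i-1)] divides
  [D_i] exactly once and does not divide the numerator of the partial sum.
  Transcendence is Liouville's theorem, and the digits [e_j] are free, which
  gives continuum many [sigma].
*)

Require Import Defs.
From mathcomp Require Import all_boot all_order all_algebra.
From mathcomp Require Import boolp classical_sets cardinality reals.
From mathcomp Require Import ring lra zify.

Set Implicit Arguments.
Unset Strict Implicit.
Unset Printing Implicit Defensive.

Import Order.TTheory GRing.Theory Num.Theory.

Local Open Scope classical_set_scope.
Local Open Scope ring_scope.

(** * The denominators and their primes *)

Definition ell_next (D j : nat) : nat := s2val (prime_above (D ^ j.+2)).

(** Since [ell] is read off from [den], the recursion calls [ell_next] on the previous denominator.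
    Starting at 3 forces [ell j >= 4], which leaves room for the digits 1 and 2 and for the tail. *)
Fixpoint den (j : nat) : nat :=
  if j is j'.+1 then den j' * ell_next (den j') j' else 3%N.

Definition ell (j : nat) : nat := ell_next (den j) j.

Lemma denS j : den j.+1 = (den j * ell j)%N.
Proof. by []. Qed.

Lemma ell_gt j : (den j ^ j.+2 < ell j)%N.
Proof. by rewrite /ell /ell_next; case: prime_above. Qed.

Lemma ell_prime j : prime (ell j).
Proof. by rewrite /ell /ell_next; case: prime_above. Qed.

Lemma den_ge3 j : (3 <= den j)%N.
Proof.
elim: j => // j IH; rewrite denS (leq_trans IH) // leq_pmulr // prime_gt0 //.
exact: ell_prime.
Qed.

Lemma den_gt0 j : (0 < den j)%N.
Proof. exact: leq_trans (den_ge3 j). Qed.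

Lemma den_lt_ell j : (den j < ell j)%N.
Proof.
apply: leq_ltn_trans (ell_gt j); rewrite -{1}(expn1 (den j)).
by rewrite leq_exp2l // (leq_trans _ (den_ge3 j)).
Qed.

Lemma ell_ge4 j : (4 <= ell j)%N.
Proof. exact: leq_ltn_trans (den_ge3 j) (den_lt_ell j). Qed.

Lemma ell_lt_den j : (ell j < den j.+1)%N.
Proof. have := den_ge3 j; have := ell_ge4 j; rewrite denS; nia. Qed.

Lemma den_growth j : (den j ^ j.+2 <= den j.+1)%N.
Proof. exact: leq_trans (ltnW (ell_gt j)) (ltnW (ell_lt_den j)). Qed.

Lemma den_gt j : (j < den j)%N.
Proof. by elim: j => // j IH; have := den_lt_ell j; have := ell_lt_den j; lia. Qed.

Lemma den_le i j : (i <= j)%N -> (den i <= den j)%N.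
Proof.
apply: (@homo_leq _ den leq) => // [? ? ?|k]; first exact: leq_trans.
exact: ltnW (ltn_trans (den_lt_ell k) (ell_lt_den k)).
Qed.

Lemma logn_ell_den j : logn (ell j) (den j.+1) = 1%N.
Proof.
rewrite denS lognM ?den_gt0 ?prime_gt0 ?ell_prime //.
rewrite (logn_prime _ (ell_prime j)) eqxx.
by rewrite lognE gtnNdvd ?den_gt0 ?den_lt_ell // !andbF.
Qed.

(** * The series and its partial sums *)

Fixpoint num (b : nat -> bool) (j : nat) : nat :=
  if j is j'.+1 then (num b j' * ell j' + (b j').+1)%N else 1%N.

Lemma num_gt0 b j : (0 < num b j)%N.
Proof. by case: j => //= j; rewrite addnS. Qed.

(** Modulo [ell j] the numerator is the last digit; this is why bits are coded by the nonzero digits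
    1 and 2. *)
Lemma logn_ell_num b j : logn (ell j) (num b j.+1) = 0%N.
Proof.
rewrite lognE /= dvdn_addr ?dvdn_mull // gtnNdvd ?andbF //.
by apply: leq_trans (ell_ge4 j); case: (b j).
Qed.

Section Sigma.
Variables (R : realType) (b : nat -> bool).

Definition conv (j : nat) : R := (num b j)%:R / (den j)%:R.

Lemma den_gt0R j : 0 < (den j)%:R :> R.
Proof. by rewrite ltr0n den_gt0. Qed.

Lemma convS j : conv j.+1 = conv j + (b j).+1%:R / (den j.+1)%:R.
Proof.
rewrite /conv denS /= natrM natrD natrM; field.
by rewrite !pnatr_eq0 -!lt0n den_gt0 (leq_trans _ (ell_ge4 j)).
Qed.

Lemma conv_gt0 j : 0 < conv j.
Proof. by rewrite divr_gt0 ?den_gt0R // ltr0n num_gt0. Qed.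

Lemma conv_lt_S j : conv j < conv j.+1.
Proof. by rewrite convS ltrDl divr_gt0 ?den_gt0R. Qed.

Lemma inv_denS j : 4 / (den j.+1)%:R <= (den j)%:R^-1 :> R.
Proof.
rewrite ler_pdivrMr ?den_gt0R // ler_pdivlMl ?den_gt0R // -natrM.
by rewrite ler_nat denS leq_mul2l ell_ge4 orbT.
Qed.

(** Four units of the next level fit into one unit of this level, so the later terms cannot make up
    for raising the digit by one. This separates distinct digit sequences. *)
Lemma conv_tail j : conv j.+1 + 3 / (den j.+2)%:R < conv j + (b j).+2%:R / (den j.+1)%:R.
Proof.
rewrite convS -addrA ltrD2l -[(b j).+2%:R]natr1 [ltRHS]mulrDl ltrD2l mul1r.
apply: lt_le_trans (inv_denS _).
by rewrite ltr_pM2r ?invr_gt0 ?den_gt0R // ltr_nat.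
Qed.

Lemma conv_upper j : conv j.+1 + 3 / (den j.+2)%:R <= conv j + 3 / (den j.+1)%:R.
Proof.
apply: le_trans (ltW (conv_tail j)) _.
by rewrite lerD2l ler_pM2r ?invr_gt0 ?den_gt0R // ler_nat; case: (b j).
Qed.

Lemma conv_mono i j : (i <= j)%N -> conv i <= conv j.
Proof.
apply: (@homo_leq _ conv <=%R) => [x|y x z|k]; 
  [exact: lexx|exact: le_trans|exact: ltW (conv_lt_S k)].
Qed.

Lemma conv_inj : injective conv.
Proof.
have lt i j : (i < j)%N -> conv i < conv j.
  by move=> ij; apply: lt_le_trans (conv_lt_S i) (conv_mono ij).
move=> i j E; by case: (ltngtP i j) => // /lt; rewrite E ltxx.
Qed.

Lemma conv_le_upper i j : conv i <= conv j + 3 / (den j.+1)%:R.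
Proof.
(* The bounds [U] decrease while the partial sums increase. *)
pose U j := conv j + 3 / (den j.+1)%:R.
have Umono k l : (k <= l)%N -> U l <= U k.
  elim: l => [|l IH]; first by rewrite leqn0 => /eqP ->.
  rewrite leq_eqVlt => /predU1P[-> //|kl].
  exact: le_trans (conv_upper l) (IH kl).
have cU k : conv k <= U k by rewrite lerDl divr_ge0 // ltW ?den_gt0R.
case: (leqP i j) => ij; first exact: le_trans (conv_mono ij) (cU j).
exact: le_trans (cU i) (Umono _ _ (ltnW ij)).
Qed.

Definition sigma : R := sup (range conv).

Lemma sigma_le j : sigma <= conv j + 3 / (den j.+1)%:R.
Proof.
by apply: ge_sup; [exists (conv 0); exists 0%N|move=> _ [i _ <-]; exact: conv_le_upper].
Qed.

Lemma sigma_gt j : conv j < sigma.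
Proof.
apply: lt_le_trans (conv_lt_S j) _; apply: ub_le_sup; last by exists j.+1.
by exists (conv 0 + 3 / (den 1)%:R) => _ [i _ <-]; exact: conv_le_upper.
Qed.

Lemma sigma_gt0 : 0 < sigma.
Proof. exact: lt_trans (conv_gt0 0) (sigma_gt 0). Qed.

Lemma sigma_dist j : `|sigma - conv j| <= 3 / (den j.+1)%:R.
Proof.
by rewrite ger0_norm ?subr_ge0 ?(ltW (sigma_gt j)) // lerBlDl sigma_le.
Qed.
End Sigma.

(** * Injectivity in the digits *)

Lemma eq_num (b c : nat -> bool) j :
  (forall i, (i < j)%N -> b i = c i) -> num b j = num c j.
Proof.
elim: j => //= j IH bc; rewrite bc // IH // => i ij.
by apply: bc; apply: ltn_trans ij _.
Qed.

Lemma sigma_inj (R : realType) : injective (sigma R).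
Proof.
have lt b c j : (forall i, (i < j)%N -> b i = c i) -> b j = false -> c j = true ->
    sigma R b < sigma R c.
  move=> bc bj cj; apply: le_lt_trans (sigma_le _ _ j.+1) _.
  apply: lt_trans (conv_tail _ _ _) _; apply: le_lt_trans (sigma_gt _ _ j.+1).
  by rewrite convS bj cj /conv (eq_num bc).
move=> b c E; apply: contrapT => bc.
have ex : exists j, b j != c j.
  apply: contrapT => H; apply: bc; apply: funext => j.
  by apply/eqP/contraT => Hj; case: H; exists j.
have [j bcj minj] := ex_minnP ex.
have bci i : (i < j)%N -> b i = c i.
  by move=> ij; apply/eqP/contraT => /minj; rewrite leqNgt ij.
case bj: (b j) bcj; case cj: (c j) => // _.
- by have := lt c b j (fun i h => esym (bci i h)) cj bj; rewrite E ltxx.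
- by have := lt b c j bci bj cj; rewrite E ltxx.
Qed.

(** * Polynomial estimates and Liouville numbers *)

Section Bounds.
Variable R : realType.
Implicit Types (x y xi : R).

(** Dividing out the linear factor at [x] leaves a cofactor bounded near [x]. *)
Lemma root_bound (p : {poly R}) x : root p x ->
  exists2 C, 0 <= C & forall y, `|x - y| <= 1 -> `|p.[y]| <= C * `|x - y|.
Proof.
move=> /factor_theorem[q ->]; have [C HC] := poly_disk_bound q (`|x| + 1).
exists `|C| => // y xy; rewrite hornerM hornerXsubC normrM (distrC y).
apply: ler_wpM2r => //; apply: le_trans (ler_norm C); apply: HC.
have -> : y = x - (x - y) by ring.
by apply: le_trans (ler_normB _ _) _; rewrite lerD2l.
Qed.

Lemma exprn_bound (m : nat) x :
  exists2 C, 0 <= C & forall y, `|x - y| <= 1 -> `|x ^+ m - y ^+ m| <= C * `|x - y|.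
Proof.
have /root_bound[C C0 HC] : root ('X^m - (x ^+ m)%:P) x.
  by rewrite rootE !hornerE subrr.
by exists C => // y /HC; rewrite !hornerE distrC.
Qed.

Lemma positive_dist_bound x (s : seq (int * int)) :
  exists2 d : R, 0 < d & forall pq, pq \in s ->
    0 < `|x - pq.1%:~R / pq.2%:~R| -> d <= `|x - pq.1%:~R / pq.2%:~R|.
Proof.
elim: s => [|a s [d d0 Hd]]; first by exists 1.
set u := `|x - a.1%:~R / a.2%:~R|.
have [u0|u0] := ltP 0 u.
  exists (Num.min d u); first by rewrite lt_min d0.
  move=> pq; rewrite inE => /predU1P[-> _|/Hd H /H]; first by rewrite ge_min lexx orbT.
  by move=> {}H; rewrite ge_min H.
exists d => // pq; rewrite inE => /predU1P[->|/Hd//].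
by rewrite -/u ltNge u0.
Qed.

(** Finitely many fractions keep a distance [d > 0] from an irrational number, so a close enough
    approximation is a new pair. *)
Lemma LiouvilleI x :
  (forall a b : int, b != 0 -> x <> a%:~R / b%:~R) ->
  (forall N : nat, exists p q : int,
     2 <= q /\ `|x - p%:~R / q%:~R| < q%:~R ^- N) ->
  Liouville x.
Proof.
move=> irr appr N _ /finite_seqP[s Es].
have [d d0 Hd] := positive_dist_bound x s.
(* As [q >= 2], this gives [q ^- M <= 2 ^- M < d], and [M >= N] keeps the approximation of order
   [N]. *)
pose M := maxn N (Num.bound d^-1).
have [p [q [q2 Hpq]]] := appr M.
have q2R : 2 <= q%:~R :> R by rewrite (ler_int _ 2 q).
have q0R : 0 < q%:~R :> R by apply: lt_le_trans q2R.
have q1R : 1 <= q%:~R :> R by apply: le_trans q2R; lra.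
have pos : 0 < `|x - p%:~R / q%:~R|.
  rewrite normr_gt0 subr_eq0; apply/eqP/irr; lia.
have : (p, q) \in s.
  suff : [set` s] (p, q) by [].
  rewrite -Es /=; split => //; rewrite pos /=; apply: lt_le_trans Hpq _.
  by rewrite lef_pV2 ?posrE ?exprn_gt0 // ler_weXn2l // leq_maxl.
move=> /Hd /(_ pos); apply/negP; rewrite -ltNge; apply: lt_trans Hpq _.
rewrite -[d]invrK ltf_pV2 ?posrE ?invr_gt0 ?exprn_gt0 //.
apply: lt_le_trans (upper_nthrootP (leq_maxr N _)) _.
by rewrite lerXn2r // ?nnegrE ltW.
Qed.

(** Bounded denominators would bound the numerators too and leave finitely many pairs. *)
Lemma Liouville_large xi (N Q : nat) : Liouville xi -> (0 < N)%N ->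
  exists (p : int) (q : nat),
    [/\ (2 <= q)%N, (Q <= q)%N & `|xi - p%:~R / q%:R| < q%:R ^- N].
Proof.
move=> L N0; apply: contrapT => no; apply: (L N N0).
pose K := Num.bound ((`|xi| + 1) * Q%:R).
(* The shift by [K] lets naturals code numerators of either sign. *)
pose f (ij : nat * nat) : int * int := (Posz ij.1 - Posz K, Posz ij.2).
apply: sub_finite_set (finite_image f (finite_setX (finite_II (K + K)) (finite_II Q))).
move=> [p q] /= [q2 /andP[_ Hpq]].
have [n En] : exists n : nat, q = Posz n by exists `|q|%N; lia.
subst q; rewrite -pmulrn in Hpq.
have nQ : (n < Q)%N.
  by rewrite ltnNge; apply/negP => Qn; apply: no; exists p, n.
have n0 : 0 < n%:R :> R by rewrite ltr0n; lia.
have n1 : 1 <= n%:R :> R by rewrite ler1n; lia.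
have pK : `|p| < Posz K.
  rewrite -(ltr_int R) intr_norm -pmulrn.
  apply: le_lt_trans (archi_boundP _); last by rewrite mulr_ge0 ?addr_ge0.
  have -> : p%:~R = (xi - (xi - p%:~R / n%:R)) * n%:R :> R by field; rewrite gt_eqF.
  rewrite normrM normr_nat; apply: ler_pM => //; last by rewrite ler_nat ltnW.
  apply: le_trans (ler_normB _ _) _; rewrite lerD2l.
  apply: le_trans (ltW Hpq) _; rewrite invf_le1 ?exprn_gt0 //.
  by rewrite exprn_ege1.
exists (absz (p + Posz K), n) => /=; first by split => //=; lia.
by rewrite /f /=; congr pair; lia.
Qed.

(** With exponent 1, the numerator would lie strictly between 0 and 1 in absolute value. *)
Lemma Liouville_neq0 xi : Liouville xi -> xi != 0.
Proof.
move=> L; apply/eqP => E; have [[p q] /= [q2]] := infinite_setN0 (L 1%N isT).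
have q0 : 0 < q%:~R :> R by rewrite ltr0z; lia.
rewrite E sub0r normrN normrM normfV (gtr0_norm q0) expr1 => /andP[].
rewrite pmulr_lgt0 ?invr_gt0 // gtr_pMl ?invr_gt0 // -intr_norm ltr0z.
rewrite (ltr_int _ _ 1); lia.
Qed.
End Bounds.

(** * Approximation of [sigma * xi ^+ m] *)

Lemma den_gap (q e B J : nat) : (den (J + e) <= q)%N ->
  exists2 i, (J <= i)%N &
    (den i <= q)%N /\ (q ^ B <= den i.+1)%N \/
    (den i <= q ^ B)%N /\ (q ^ e <= den i.+1)%N.
Proof.
move=> Jq; have q0 : (0 < q)%N := leq_trans (den_gt0 _) Jq.
have [[|k] qk mink] := ex_minnP (ex_intro (fun i => q < den i)%N q (den_gt q)).
  by have := den_le (leq0n (J + e)); lia.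
have kq : (den k <= q)%N by rewrite leqNgt; apply/negP => /mink; rewrite ltnn.
have Jk : (J + e <= k)%N.
  by rewrite leqNgt; apply/negP => kJ; have := den_le kJ; lia.
(* [den k.+1] is the first denominator above [q]. If it is below [q ^ B], the gap after it is used:
   [den k.+2] is at least its power [k.+3], and [k.+3 >= e]. *)
have [Bk|kB] := leqP (q ^ B) (den k.+1).
  by exists k; [lia|left].
exists k.+1; [lia|right]; split; first exact: ltnW.
apply: leq_trans (den_growth _); apply: (@leq_trans (q ^ k.+3)).
  by rewrite leq_pexp2l //; lia.
by rewrite leq_exp2r // ltnW.
Qed.

Section SigmaPower.
Variables (R : realType) (b : nat -> bool).
Local Notation sigma := (sigma R b).

(** The two errors add up to at most [K * q ^- e]. As [K < q], one factor [q] absorbs the constant,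
    and the strict bound on [e] pays for it. *)
Lemma sigma_exprn_error (m : nat) (xi : R) : exists K : nat,
  forall (N a e i q : nat) (p : int),
    (K < q)%N -> (den i <= q ^ a)%N -> (q ^ e <= den i.+1)%N ->
    ((a + m) * N < e)%N -> `|xi - p%:~R / q%:R| < q%:R ^- e ->
    `|sigma * xi ^+ m - conv R b i * (p%:~R / q%:R) ^+ m| < (den i * q ^ m)%:R ^- N.
Proof.
have [C C0 HC] := exprn_bound m xi.
pose K := 3 * `|xi| ^+ m + sigma * C.
have s0 : 0 <= sigma := ltW (sigma_gt0 R b).
have K0 : 0 <= K by rewrite addr_ge0 ?mulr_ge0 ?exprn_ge0.
exists (Num.bound K) => N a e i q p Kq iq qi Ne; set y := _ / _ => Hy.
have q0 : (0 < q)%N by lia.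
have q0R : 0 < q%:R :> R by rewrite ltr0n.
have qe0 : 0 < q%:R ^+ e :> R by rewrite exprn_gt0.
have y1 : `|xi - y| <= 1.
  by apply: le_trans (ltW Hy) _; rewrite invf_le1 // exprn_ege1 // ler1n.
have -> : sigma * xi ^+ m - conv R b i * y ^+ m =
    (sigma - conv R b i) * xi ^+ m + conv R b i * (xi ^+ m - y ^+ m) by ring.
apply: (@le_lt_trans _ _ (K * q%:R ^- e)).
  apply: le_trans (ler_normD _ _) _.
  rewrite (normrM (_ - _)) (normrM (conv R b i)) normrX mulrDl.
  apply: lerD.
    rewrite mulrAC; apply: ler_wpM2r; first exact: exprn_ge0.
    apply: le_trans (sigma_dist R b i) _; rewrite ler_pM2l //.
    by rewrite lef_pV2 ?posrE ?den_gt0R // -natrX ler_nat.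
  rewrite -[leRHS]mulrA; apply: ler_pM => //.
    by rewrite gtr0_norm ?conv_gt0 //; exact: ltW (sigma_gt _ _ _).
  by apply: le_trans (HC _ y1) _; rewrite ler_wpM2l // ltW.
apply: (@lt_le_trans _ _ (q%:R * q%:R ^- e)).
  rewrite ltr_pM2r ?invr_gt0 //; apply: lt_trans (archi_boundP K0) _.
  by rewrite ltr_nat.
rewrite ler_pdivrMr // ler_pdivlMl ?exprn_gt0 ?ltr0n ?muln_gt0 ?den_gt0 ?expn_gt0 ?q0 //.
rewrite -!natrX -natrM ler_nat.
apply: (@leq_trans ((q ^ a * q ^ m) ^ N * q)).
  case: (posnP N) => [->|N0]; first by rewrite !expn0.
  by rewrite leq_mul2r leq_exp2r // leq_mul2r iq !orbT.
by rewrite -expnD -expnM -expnSr leq_pexp2l.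
Qed.

Lemma sigma_exprn_approx (m N J : nat) (xi : R) : Liouville xi ->
  exists (i : nat) (p : int) (q : nat), [/\ (J <= i)%N, (0 < q)%N &
    `|sigma * xi ^+ m - (Posz (num b i) * p ^+ m)%:~R / (den i * q ^ m)%:R|
      < (den i * q ^ m)%:R ^- N].
Proof.
move=> L; have [K HK] := sigma_exprn_error m xi.
(* [B] suits the error bound with [a = 1], and [e] suits it with [a = B]; since [e >= B], the same
   [p / q] serves both cases of the gap. *)
pose B := ((1 + m) * N).+1; pose e := ((B + m) * N + B).+1.
have [p [q [q2 Qq Hpq]]] := Liouville_large (den (J + e) + K.+1) L (isT : (0 < e)%N).
have q1 : 1 <= q%:R :> R by rewrite ler1n; lia.
have E i : (Posz (num b i) * p ^+ m)%:~R / (den i * q ^ m)%:R =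
    conv R b i * (p%:~R / q%:R) ^+ m :> R.
  rewrite intrM rmorphXn natrM natrX expr_div_n -pmulrn /conv; field.
  by rewrite expf_neq0 // gt_eqF ?ltr0n ?den_gt0 //; lia.
have [i Ji [[iq qi]|[iq qi]]] := @den_gap q e B J ltac:(lia);
  exists i, p, q; split => //; try lia.
  rewrite E; apply: (HK _ 1%N B) => //; [lia|].
  apply: lt_le_trans Hpq _.
  by rewrite lef_pV2 ?posrE ?exprn_gt0 ?ler_weXn2l ?(lt_le_trans ltr01) // /e; lia.
by rewrite E; apply: (HK _ B e) => //; rewrite /e; lia.
Qed.

(* A rational value of [sigma * xi ^+ m] would equal some approximation exactly,
   although the exponent of [ell k] in the latter is -1 modulo [m] and [ell k]
   is too large to occur in the former. *)
Lemma sigma_exprn_irrational (m : nat) (xi : R) (a c : int) :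
  (2 <= m)%N -> Liouville xi -> c != 0 -> sigma * xi ^+ m <> a%:~R / c%:~R.
Proof.
move=> m2 L c0 E.
have a0 : a != 0.
  apply/eqP => a0; move/eqP: E; rewrite a0 mul0r mulf_eq0 expf_eq0.
  by rewrite (negPf (Liouville_neq0 L)) andbF orbF gt_eqF ?sigma_gt0.
(* Here [k >= |a| + |c|], so [ell k] exceeds both and [Q >= |c|]. With exponent 2, the difference
   times [c * Q] is then an integer smaller than 1 in absolute value. *)
have [[|k] [p [q [Jk q0]]]] := sigma_exprn_approx m 2 (`|a| + `|c|).+1%N L.
  by [].
rewrite E; set n := num b k.+1; set Q := (den k.+1 * q ^ m)%N => H.
have kl := den_lt_ell k; have ld := ell_lt_den k; have kd := den_gt k.
have Qd : (den k.+1 <= Q)%N by rewrite leq_pmulr // expn_gt0 q0.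
have Q0R : 0 < Q%:R :> R by rewrite ltr0n (leq_trans _ Qd) // den_gt0.
have c0R : c%:~R != 0 :> R by rewrite intr_eq0.
have EQ : a * Posz Q = c * (Posz n * p ^+ m).
  apply/eqP; rewrite -subr_eq0; apply/eqP.
  suff : `|a * Posz Q - c * (Posz n * p ^+ m)| < 1 by lia.
  set z := Posz n * p ^+ m in H *; rewrite -(ltr_int R) intr_norm.
  have -> : (a * Posz Q - c * z)%:~R =
      (a%:~R / c%:~R - z%:~R / Q%:R) * (c%:~R * Q%:R) :> R.
    by rewrite intrB !intrM -pmulrn; field; rewrite c0R gt_eqF.
  rewrite normrM normrM normr_nat -ltr_pdivlMr ?mulr_gt0 ?normr_gt0 //.
  apply: lt_le_trans H _; rewrite mul1r lef_pV2 ?posrE ?mulr_gt0 ?exprn_gt0 ?normr_gt0 //.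
  rewrite expr2 ler_pM2r // -intr_norm -[Q%:R]/(Q%:~R) ler_int; lia.
have {EQ} EQ : (`|a| * Q = `|c| * (n * `|p| ^ m))%N.
  by have := congr1 absz EQ; rewrite !abszM abszX !absz_nat.
have l_gt x : x != 0 -> (`|x| <= `|a| + `|c|)%N -> logn (ell k) `|x|%N = 0%N.
  by move=> x0 xle; rewrite lognE gtnNdvd ?andbF //; lia.
have p0 : (0 < `|p|)%N.
  rewrite lt0n; apply/eqP => p0; move: EQ; rewrite p0 exp0n ?muln0; last by lia.
  move/eqP; rewrite muln_eq0 absz_eq0 (negPf a0) /= => /eqP; have := den_gt0 k.+1; lia.
move: EQ (logn_ell_den k) (logn_ell_num b k) (den_gt0 k.+1) (num_gt0 b k.+1).
rewrite /Q /n; move: (den k.+1) (num b k.+1) => d u EQ ld1 lu0 d0 u0.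
move: (congr1 (logn (ell k)) EQ).
rewrite !lognM ?muln_gt0 ?expn_gt0 ?d0 ?u0 ?q0 ?p0 ?absz_gt0 //.
rewrite !lognX ld1 lu0 (l_gt a) ?(l_gt c) ?leq_addr ?leq_addl // !add0n.
(* The multiplicity of [ell k] is 1 modulo [m] on the left and 0 on the right. *)
move=> /(congr1 (modn^~ m)).
by rewrite modnMr addnC (mulnC m) modnMDl modn_small.
Qed.

Lemma sigma_exprn_Liouville (m : nat) (xi : R) :
  (2 <= m)%N -> Liouville xi -> Liouville (sigma * xi ^+ m).
Proof.
move=> m2 L; apply: LiouvilleI => [a c|N]; first exact: sigma_exprn_irrational.
have [i [p [q [_ q0 H]]]] := sigma_exprn_approx m N 0 L.
exists (Posz (num b i) * p ^+ m), (Posz (den i * q ^ m)); split; last by rewrite -pmulrn.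
rewrite lez_nat; apply: leq_trans (ltnW (den_ge3 i)) _.
by rewrite leq_pmulr // expn_gt0 q0.
Qed.

(** * Transcendence *)

Lemma horner_int_clear_den (P : {poly int}) (n : int) (d : nat) : (0 < d)%N ->
  (map_poly intr P).[n%:~R / d%:R] * d%:R ^+ size P \is a @Num.int R.
Proof.
move=> d0; have d0R : d%:R != 0 :> R by rewrite pnatr_eq0 -lt0n.
rewrite horner_coef mulr_suml; apply: rpred_sum => i _; rewrite coef_map /=.
have iP : (i <= size P)%N.
  exact: ltnW (leq_trans (ltn_ord i) (size_poly _ _)).
have -> : (P`_i)%:~R * (n%:~R / d%:R) ^+ i * d%:R ^+ size P =
    (P`_i)%:~R * (n%:~R ^+ i * d%:R ^+ (size P - i)) :> R.
  by rewrite -{1}(subnK iP) exprD expr_div_n; field; rewrite expf_neq0.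
by rewrite !rpredM ?rpredX ?intr_int ?natr_int.
Qed.

(** The partial sums are pairwise distinct, too many to be roots of [P]. *)
Lemma conv_not_root (P : {poly R}) (J : nat) : P != 0 ->
  exists2 j, (J <= j)%N & P.[conv R b j] != 0.
Proof.
move=> P0; apply: contrapT => no.
pose rs := [seq conv R b (J + i) | i <- iota 0 (size P)].
have : (size rs < size P)%N.
  apply: max_poly_roots P0 _ _.
    apply/allP => _ /mapP[i _ ->]; rewrite rootE; apply/contraT => H.
    by case: no; exists (J + i)%N => //; rewrite leq_addr.
  rewrite map_inj_uniq ?iota_uniq // => i j /conv_inj; lia.
by rewrite size_map size_iota ltnn.
Qed.

Lemma sigma_transcendental : transcendental sigma.
Proof.
case=> p p0 rp; have [P [a a0 Ep]] := rat_poly_scale p.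
have P0 : map_poly intr P != 0 :> {poly R}.
  rewrite map_poly_eq0_id0 ?intr_eq0 ?lead_coef_eq0.
    by apply: contraNneq p0 => P0; rewrite Ep P0 rmorph0 scaler0.
  by apply: contraNneq p0 => P0; rewrite Ep P0 rmorph0 scaler0.
have rP : root (map_poly intr P) sigma.
  move: rp; rewrite Ep map_polyZ /= rootZ ?fmorph_eq0 ?invr_eq0 ?intr_eq0 //.
  rewrite -map_poly_comp /=; congr (is_true (root _ _)).
  by apply: eq_map_poly => z /=; rewrite ratr_int.
have [C C0 HC] := root_bound rP.
(* For such [j], [den j ^ (j.+2 - size P)] exceeds [3 * C]. *)
have [j Jj nr] := conv_not_root (size P + Num.bound (3 * C)) P0.
(* This nonzero integer is at least 1 in absolute value, but the closeness of [conv R b j] to the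
   root makes it smaller. *)
have := horner_int_clear_den P (num b j) (den_gt0 j).
rewrite -pmulrn -/(conv R b j) => /norm_intr_ge1.
have dj := den_gt0R R j.
rewrite (mulf_neq0 nr) ?expf_neq0 ?gt_eqF // => /(_ isT); apply/negP; rewrite -ltNge.
have d3 := sigma_dist R b j.
have grow : 3 * C * (den j)%:R ^+ size P < (den j.+1)%:R.
  apply: lt_le_trans (_ : _ < (den j ^ j.+2)%:R) _; last by rewrite ler_nat den_growth.
  have -> : (j.+2 = (j.+2 - size P) + size P)%N by lia.
  rewrite natrX exprD ltr_pM2r ?exprn_gt0 //.
  have bj : (Num.bound (3 * C) <= j.+2 - size P)%N by lia.
  apply: lt_le_trans (upper_nthrootP bj) _.
  by rewrite lerXn2r ?nnegrE // ler_nat (leq_trans _ (den_ge3 j)).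
have dS := den_gt0R R j.+1.
have d1 : `|sigma - conv R b j| <= 1.
  apply: le_trans d3 _; rewrite ler_pdivrMr // mul1r ler_nat.
  exact: den_ge3.
rewrite normrM normrX normr_nat.
apply: le_lt_trans (_ : C * (3 / (den j.+1)%:R) * (den j)%:R ^+ size P < 1).
  apply: ler_wpM2r; first by rewrite exprn_ge0 // ltW.
  by apply: le_trans (HC _ d1) _; rewrite ler_wpM2l.
have -> : C * (3 / (den j.+1)%:R) * (den j)%:R ^+ size P =
  (3 * C * (den j)%:R ^+ size P) / (den j.+1)%:R by ring.
by rewrite ltr_pdivrMr // mul1r.
Qed.
End SigmaPower.

(** * Cardinality *)

(* Codes the Dedekind cut of [x] along an enumeration of the rationals. *)
Definition cut (R : realType) (x : R) (n : nat) : bool :=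
  if unpickle n is Some q then ratr (q : rat) < x else false.

Lemma cut_inj (R : realType) : injective (@cut R).
Proof.
have lt (x y : R) : x < y -> cut x <> cut y.
  move=> /rat_in_itvoo[q]; rewrite in_itv /= => /andP[xq qy].
  move=> /(congr1 (@^~ (pickle q))); rewrite /cut pickleK qy.
  by rewrite ltNge ltW.
move=> x y E; case: (ltgtP x y) => // /lt; [exact|by move=> /(_ (esym E))].
Qed.

Theorem theorem1p5 (R : realType) :
  ([set sigma : R |
     [/\ 0 < sigma,
         transcendental sigma &
         forall (m : nat) (xi : R), (2 <= m)%N -> Liouville xi ->
           Liouville (sigma * xi ^+ m)]] #= [set: R])%card.
Proof.
(* By Cantor-Bernstein, an injection of the reals into [S] suffices. *)
rewrite card_eq_le card_leT /=; set S := [set _ | _].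
have inj : injective (fun x : R => sigma R (cut x)).
  by move=> x y /sigma_inj /cut_inj.
apply: card_le_trans (_ : (_ #<= range (fun x : R => sigma R (cut x)))%card) _.
  have := inj_card_eq (in2W inj : {in [set: R] &, injective _}).
  by rewrite card_eq_le => /andP[].
apply: subset_card_le => _ [x _ <-]; split.
- exact: sigma_gt0.
- exact: sigma_transcendental.
- by move=> m xi; exact: sigma_exprn_Liouville.
Qed.
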